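(* Let $P,Q$ be integers with $P\ge 2$, $Q\neq 0$, $-P-1\le Q\le P-1$ and $D=P^2-4Q>0$, and let $\alpha=\frac{P+\sqrt D}{2}$, $\beta=\frac{P-\sqrt D}{2}$, where $\alpha/\beta$ is not a root of unity. Let $(U_n)$ and $(V_n)$ be the Lucas sequences of the first and second kind with parameters $(P,Q)$. Assume there are real constants $s_1,s_2,t_1,t_2>0$ and $i_1,i_2,j_1,j_2$ such that for all $k\ge 1$ $$s_1\alpha^{k-i_1}\le U_k\le s_2\alpha^{k+i_2},\qquad t_1\alpha^{k-j_1}\le V_k\le t_2\alpha^{k+j_2}.$$ Let $(a,b,c,d)\in A$ and set $$B_0=\min_{I\in\mathbb Z}\left|\alpha^I-\frac{d}{c\sqrt D}\right|,\qquad B_1=\min_{I\in\mathbb Z}\left|\alpha^I-\frac{d}{c}\right|.$$ (1) If $x=U_i$, $y=U_j$, $z=U_k$ with $1\le i\le j\le k$ is a solution of $ax^2+by^2+cz^2=dxyz$ and $B_0\neq 0$, then there exists an effectively computable constant $C_0$ such that $i\le C_0$. (2) If $x=V_i$, $y=V_j$, $z=V_k$ with $1\le i\le j\le k$ is a solution of $ax^2+by^2+cz^2=dxyz$ and $B_1\neq 0$, then there exists an effectively computable constant $C_1$ such that $i\le C_1$.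
   Context: The sequences are defined by $U_0=0$, $U_1=1$, $U_n=PU_{n-1}-QU_{n-2}$ and $V_0=2$, $V_1=P$, $V_n=PV_{n-1}-QV_{n-2}$ for $n\ge2$. The set $A$ is $A=\{(1,1,1,1),(1,1,1,3),(1,1,2,2),(1,1,2,4),(1,2,3,6),(1,1,5,5)\}$ (the coefficient tuples of Rosenberger's generalized Markoff equations $ax^2+by^2+cz^2=dxyz$). *)

(* Defs.v *)
From HB Require Import structures.
From mathcomp Require Import all_boot all_order all_algebra.
From mathcomp Require Import all_classical all_reals all_analysis.
Set Implicit Arguments.
Unset Strict Implicit.
Unset Printing Implicit Defensive.
Import Order.TTheory GRing.Theory Num.Theory.
Local Open Scope classical_set_scope.
Local Open Scope ring_scope.

Fixpoint lucas (x0 x1 P Q : int) (n : nat) : int :=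
  match n with
  | 0 => x0
  | n1.+1 =>
    match n1 with
    | 0 => x1
    | n2.+1 => P * lucas x0 x1 P Q n1 - Q * lucas x0 x1 P Q n2
    end
  end.

Definition lucasU (P Q : int) : nat -> int := lucas 0 1 P Q.
Definition lucasV (P Q : int) : nat -> int := lucas 2 P P Q.

Definition lucasD (P Q : int) : int := P ^+ 2 - 4 * Q.

Definition lucas_alpha (R : realType) (P Q : int) : R :=
  (P%:~R + Num.sqrt (lucasD P Q)%:~R) / 2.
Definition lucas_beta (R : realType) (P Q : int) : R :=
  (P%:~R - Num.sqrt (lucasD P Q)%:~R) / 2.

(* The (a, b, c, d) of the equations a x^2 + b y^2 + c z^2 = d x y z. *)
Definition markoff_rosenberger : seq (int * int * int * int) :=
  [:: (1, 1, 1, 1); (1, 1, 1, 3); (1, 1, 2, 2);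
      (1, 1, 2, 4); (1, 2, 3, 6); (1, 1, 5, 5)].

(* The minimum of |alpha^I - x| over I in Z, written as an infimum; it is
   attained when 1 < alpha and 0 < x, see [min_dist_pow_attained]. *)
Definition min_dist_pow (R : realType) (alpha x : R) : R :=
  inf (range (fun I : int => `|alpha ^ I - x|)).

Lemma min_dist_pow_attained (R : realType) (alpha x : R) :
  1 < alpha -> 0 < x ->
  exists I : int, min_dist_pow alpha x = `|alpha ^ I - x|.
Proof.
move=> a1 x0.
have a0 : 0 < alpha by exact: lt_trans a1.
have lna : 0 < ln alpha by rewrite ln_gt0.
have powE (I : int) : alpha ^ I = expR (I%:~R * ln alpha).
  by rewrite -powR_intmul ?ltW// /powR gt_eqF.
have mono (I J : int) : I <= J -> alpha ^ I <= alpha ^ J.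
  by move=> IJ; rewrite !powE ler_expR ler_pM2r// ler_int.
pose F := Num.floor (ln x / ln alpha).
have Fx : alpha ^ F <= x.
  rewrite powE -[leRHS]lnK ?posrE// ler_expR -ler_pdivlMr//.
  exact: floor_le.
have xF : x <= alpha ^ (F + 1).
  rewrite powE -[leLHS]lnK ?posrE// ler_expR -ler_pdivrMr//.
  exact/ltW/floorD1_gt.
have attained (K : int) : (forall J : int, `|alpha ^ K - x| <= `|alpha ^ J - x|) ->
    min_dist_pow alpha x = `|alpha ^ K - x|.
  move=> minK; apply/eqP; rewrite eq_le; apply/andP; split.
    apply: ge_inf; last by exists K.
    by exists 0 => _ [J _ <-].
  apply: lb_le_inf; first by exists `|alpha ^ K - x|, K.
  by move=> _ [J _ <-].
have low (J : int) : J <= F -> `|alpha ^ F - x| <= `|alpha ^ J - x|.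
  move=> /mono JF; rewrite !(distrC _ x) !ger0_norm ?subr_ge0//.
    by rewrite lerB.
  exact: le_trans Fx.
have high (J : int) : F + 1 <= J -> `|alpha ^ (F + 1) - x| <= `|alpha ^ J - x|.
  move=> /mono FJ; rewrite !ger0_norm ?subr_ge0//; first by rewrite lerB.
  exact: le_trans FJ.
have split_F (J : int) : J <= F \/ F + 1 <= J.
  by case: (leP J F) => JF; [left | right; rewrite -ltzD1 ltrD2r].
have [le|/ltW le] := leP `|alpha ^ F - x| `|alpha ^ (F + 1) - x|.
  exists F; apply: attained => J.
  by case: (split_F J) => [/low //|/high]; exact: le_trans.
exists (F + 1); apply: attained => J.
by case: (split_F J) => [/low|/high //]; exact: le_trans.
Qed.

(* Codes of partial recursive functions of n natural arguments. *)
Inductive recfun : nat -> Type :=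
| RZero n : recfun n
| RSucc : recfun 1
| RProj n (i : 'I_n) : recfun n
| RComp m n (f : recfun m) (g : 'I_m -> recfun n) : recfun n
| RPrim n (f : recfun n) (g : recfun n.+2) : recfun n.+1
| RMu n (f : recfun n.+1) : recfun n.

(* [computes f v y]: the program f halts on input v with output y.  [RPrim]
   recurses on the first argument, g receiving the counter, the previous value
   and the parameters; [RMu] searches for the first argument. *)
Fixpoint computes n (f : recfun n) : n.-tuple nat -> nat -> Prop :=
  match f in recfun n return n.-tuple nat -> nat -> Prop with
  | RZero _ => fun _ y => y = 0%N
  | RSucc => fun v y => y = (thead v).+1
  | RProj _ i => fun v y => y = tnth v i
  | RComp m _ f g => fun v y => exists w : m.-tuple nat,
      (forall i : 'I_m, computes (g i) v (tnth w i)) /\ computes f w y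
  | RPrim _ f g => fun v y => exists s : nat -> nat,
      [/\ computes f [tuple of behead v] (s 0%N),
          forall t, (t < thead v)%N ->
            computes g [tuple of t :: s t :: behead v] (s t.+1)
        & y = s (thead v)]
  | RMu _ f => fun v y =>
      computes f [tuple of y :: v] 0%N /\
      forall t, (t < y)%N -> exists r, computes f [tuple of t :: v] r.+1
  end.

Lemma computes_fun n (f : recfun n) (v : n.-tuple nat) (y y' : nat) :
  computes f v y -> computes f v y' -> y = y'.
Proof.
elim: f v y y' => {n} [n|| n i | m n f IHf g IHg | n f IHf g IHg | n f IHf] /= v y y'.
- by move=> -> ->.
- by move=> -> ->.
- by move=> -> ->.
- move=> [w [gw fw]] [w' [gw' fw']].
  have ww' : w = w' by apply: eq_from_tnth => i; exact: IHg (gw i) (gw' i).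
  by move: fw'; rewrite -ww'; exact: IHf.
- move=> [s [s0 sS ->]] [s' [s0' sS' ->]].
  have : (thead v <= thead v)%N by [].
  elim: {1 3 4}(thead v) => [_|t IHt tv]; first exact: IHf s0 s0'.
  have := sS' _ tv; rewrite -IHt 1?ltnW// => st.
  exact: IHg (sS _ tv) st.
- move=> [fy miny] [fy' miny'].
  by have [/miny' [r fr]|/miny [r fr]|//] := ltngtP y y';
    [have := IHf _ _ _ fy fr | have := IHf _ _ _ fy' fr].
Qed.

Definition int_code (z : int) : nat :=
  match z with Posz n => n.*2 | Negz n => n.*2.+1 end.

Definition input (P Q a b c d : int) : 6.-tuple nat :=
  [tuple int_code P; int_code Q; int_code a; int_code b; int_code c; int_code d].

(* Main.v *)
(* Here alpha >= 2 and |beta| <= 1.  Write s = sqrt D for U and s = 1 for V.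
   With x <= y <= z the equation gives z / (x y) = d / c - O(1 / x), hence
     |alpha^(k - i - j) - d / (c s)| <= 42 alpha^(- i).
   If P >= 11 the left-hand side is at least alpha^-4 (for V only when d <> c,
   but d = c makes B1 = 0), so i <= 46.  There remain finitely many (P, Q), for
   each of which B0 > 0, resp. B1 > 0, bounds i.  So C0 and C1 can be taken
   independent of all parameters, and the programs computing them constant. *)
Require Import Defs.
From HB Require Import structures.
From mathcomp Require Import all_boot all_order all_algebra.
From mathcomp Require Import zify ring lra.
From mathcomp Require Import all_classical all_reals all_analysis.
Set Implicit Arguments.
Unset Strict Implicit.
Unset Printing Implicit Defensive.
Import Order.TTheory GRing.Theory Num.Theory.
Local Open Scope ring_scope.

(** * Constant programs, and bounds over finite lists *)

(** The successor is composed [N] times onto zero. Since the bounds on [i] turn out to be absolute,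
    effectivity reduces to this. *)
Lemma computes_const (n N : nat) :
  exists p : recfun n, forall v : n.-tuple nat, computes p v N.
Proof.
elim: N => [|N [p pN]]; first by exists (RZero n).
exists (RComp RSucc (fun=> p)) => v /=; exists [tuple N].
by split => [i|//]; rewrite ord1 tnth0.
Qed.

Lemma uniform_bound (T : eqType) (s : seq T) (G : T -> nat -> Prop) :
  (forall t, exists C, forall n, G t n -> (n <= C)%N) ->
  exists C, forall t n, t \in s -> G t n -> (n <= C)%N.
Proof.
move=> bG; elim: s => [|t s [C sC]]; first by exists 0%N.
have [C' tC'] := bG t; exists (maxn C C') => t' n; rewrite inE leq_max.
by case/orP => [/eqP -> /tC' ->|/sC /[apply] ->]; rewrite ?orbT.
Qed.

(** * Lucas sequences: monotonicity, size of the roots, closed forms *)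

(** For consecutive terms [u], [w], the next increment is [(P - 1 - Q) * u + (P - 1) * (w - u)], a
    sum of two nonnegative terms. *)
Lemma lucas_homo (x0 x1 P Q : int) :
  0 <= x0 -> x0 <= x1 -> 2 <= P -> Q <= P - 1 ->
  {homo lucas x0 x1 P Q : m n / (m <= n)%N >-> m <= n}.
Proof.
move=> x00 x01 P2 QP.
have step n : 0 <= lucas x0 x1 P Q n /\ lucas x0 x1 P Q n <= lucas x0 x1 P Q n.+1.
  elim: n => [//|n [n0 nS]]; split; first exact: le_trans nS.
  rewrite [leRHS]/= -/(lucas x0 x1 P Q n.+1); move: n0 nS.
  move: (lucas x0 x1 P Q n) (lucas x0 x1 P Q n.+1) => u w u0 uw.
  have h1 : 0 <= (P - 1 - Q) * u by apply: mulr_ge0; lia.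
  have h2 : 0 <= (P - 1) * (w - u) by apply: mulr_ge0; lia.
  lia.
apply: homo_leq => [//|y x z|n]; first exact: le_trans.
by have [] := step n.
Qed.

Lemma lucas_closed (R : realType) (x0 x1 P Q : int) (al be u v : R) :
  al ^+ 2 = P%:~R * al - Q%:~R -> be ^+ 2 = P%:~R * be - Q%:~R ->
  x0%:~R = u + v -> x1%:~R = u * al + v * be ->
  forall n, (lucas x0 x1 P Q n)%:~R = u * al ^+ n + v * be ^+ n.
Proof.
move=> al2 be2 e0 e1 n.
suff [] : (lucas x0 x1 P Q n)%:~R = u * al ^+ n + v * be ^+ n /\
  (lucas x0 x1 P Q n.+1)%:~R = u * al ^+ n.+1 + v * be ^+ n.+1 by [].
elim: n => [|n [IH0 IH1]]; first by rewrite !expr0 !mulr1 !expr1.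
split=> //; rewrite [lucas _ _ _ _ _]/= rmorphB !rmorphM /= -/(lucas _ _ _ _ n.+1) IH0 IH1.
have E (w : R) : w ^+ n.+2 = w ^+ 2 * w ^+ n by rewrite -exprD.
by rewrite !E al2 be2 !exprS; ring.
Qed.

Section Roots.
Context (R : realType) (P Q : int).
Hypotheses (P2 : 2 <= P) (Q0 : Q != 0) (QP1 : - P - 1 <= Q) (QP : Q <= P - 1).
Hypothesis D0 : 0 < lucasD P Q.
Let al : R := lucas_alpha R P Q.
Let be : R := lucas_beta R P Q.
Let s : R := Num.sqrt (lucasD P Q)%:~R.

Lemma sqr_sqrtD : s ^+ 2 = P%:~R ^+ 2 - 4 * Q%:~R.
Proof.
by rewrite /s sqr_sqrtr ?ler0z ?ltW// /lucasD rmorphB /= rmorphXn /= rmorphM.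
Qed.

Lemma sqrtD_ge1 : 1 <= s.
Proof.
by rewrite -sqrtr1 /s ler_wsqrtr// -[1]/(1%:~R) ler_int; move: D0; lia.
Qed.

Lemma alpha_sub_beta : al - be = s.
Proof. by rewrite /al /be /lucas_alpha /lucas_beta -/s; field. Qed.

Lemma alpha_sqr : al ^+ 2 = P%:~R * al - Q%:~R.
Proof. by have := sqr_sqrtD; rewrite /al /lucas_alpha -/s => h; nra. Qed.

Lemma beta_sqr : be ^+ 2 = P%:~R * be - Q%:~R.
Proof. by have := sqr_sqrtD; rewrite /be /lucas_beta -/s => h; nra. Qed.

Lemma alpha_mul_beta : al * be = Q%:~R.
Proof. by have := sqr_sqrtD; rewrite /al /be /lucas_alpha /lucas_beta -/s => h; nra. Qed.

(** The claim amounts to [P - 2 <= s <= P + 2]; after squaring, the two sides become [Q <= P - 1]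
    and [- P - 1 <= Q]. *)
Lemma beta_norm_le1 : `|be| <= 1.
Proof.
have s2 := sqr_sqrtD; have s1 := sqrtD_ge1.
have := P2; rewrite -(ler_int R) => P2r.
have := QP1; rewrite -(ler_int R) rmorphB rmorphN /= => QP1r.
have := QP; rewrite -(ler_int R) rmorphB /= => QPr.
rewrite /be /lucas_beta -/s ler_norml; apply/andP; split; nra.
Qed.

(** For [P >= 3], [s >= 1] is enough. For [P = 2], positivity of the discriminant and [Q != 0] force
    [Q <= -1], hence [s ^+ 2 >= 8]. *)
Lemma alpha_ge2 : 2 <= al.
Proof.
have s2 := sqr_sqrtD; have s1 := sqrtD_ge1.
rewrite /al /lucas_alpha -/s ler_pdivlMr//.
have [P3|P3] := leP 3 P.
  by move: P3; rewrite -(ler_int R) => P3; lra.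
have P2' : P = 2 by lia.
have : Q <= -1 by move: D0 Q0; rewrite P2' /lucasD; lia.
rewrite -(ler_int R) rmorphN /= => Q1.
move: s2; rewrite P2' /= => s2; nra.
Qed.

(** The product of the roots is the nonzero integer [Q]. This keeps [be] away from 0, which
    separates the inverse of [al] from that of [s]. *)
Lemma beta_norm_ge : 1 <= al * `|be|.
Proof.
have a2 := alpha_ge2.
rewrite -[al in leRHS]ger0_norm; last lra.
rewrite -normrM alpha_mul_beta -intr_norm -[1]/(1%:~R) ler_int; lia.
Qed.

(** The roots sum to [P]; this turns [P >= 11] into [al >= 10]. *)
Lemma P_le_alpha : P%:~R <= al + 1.
Proof.
have := beta_norm_le1; rewrite ler_norml => /andP[_].
by rewrite /al /be /lucas_alpha /lucas_beta; lra.
Qed.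

Lemma lucasU_closed n : (lucasU P Q n)%:~R = (al ^+ n - be ^+ n) / s.
Proof.
have s1 := sqrtD_ge1; have s0 : s != 0 by rewrite gt_eqF//; lra.
rewrite (lucas_closed (u := s^-1) (v := - s^-1) alpha_sqr beta_sqr).
- by rewrite mulNr mulrBl ![_ / s]mulrC.
- by rewrite subrr.
- by rewrite mulNr -mulrBr alpha_sub_beta mulVf.
Qed.

Lemma lucasV_closed n : (lucasV P Q n)%:~R = al ^+ n + be ^+ n.
Proof.
rewrite (lucas_closed (u := 1) (v := 1) alpha_sqr beta_sqr).
- by rewrite !mul1r.
- by [].
- by rewrite !mul1r /al /be /lucas_alpha /lucas_beta; field.
Qed.

End Roots.

(** * From the quadratic equation to a power of alpha close to d / (c s) *)

(* The quadratic equation forces z / (x y) = d / c - O(1 / x), while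
   z / (x y) is s alpha^(k - i - j) up to a factor 1 + O(alpha^(- i)). *)
Lemma markoff_approx (R : realType) (al be s e : R) (i j k : nat)
    (a b c d x y z : R) :
  2 <= al -> `|be| <= 1 -> 1 <= s -> `|e| = 1 ->
  (1 <= i)%N -> (i <= j)%N -> (j <= k)%N ->
  0 < x -> x <= y -> y <= z ->
  x = (al ^+ i + e * be ^+ i) / s ->
  y = (al ^+ j + e * be ^+ j) / s ->
  z = (al ^+ k + e * be ^+ k) / s ->
  0 < a -> 0 < b -> 0 < c -> a + b <= 2 * c -> 0 <= d -> d <= 3 * c ->
  a * x ^+ 2 + b * y ^+ 2 + c * z ^+ 2 = d * x * y * z ->
  `|al ^ (k%:Z - i%:Z - j%:Z) - d / (c * s)| <= 42 * (al ^+ i)^-1.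
Proof.
move=> al2 be1 s1 e1 i1 ij jk x0 xy yz xE yE zE a0 b0 c0 abc d0 dc eqn.
have alp : 0 < al by lra.
have ap n : 0 < al ^+ n by exact: exprn_gt0.
set t := (al ^+ i)^-1.
have tp : 0 < t by rewrite /t invr_gt0.
have th : t <= 2^-1.
  rewrite /t lef_pV2 ?posrE//.
  by apply: (le_trans al2); rewrite -[leLHS]expr1 ler_weXn2l//; lra.
(* [v n] is the ratio of the n-th term to [al ^+ n / s]; for [n >= i] it is within [t <= 1/2] of
   1. *)
pose v n := 1 + e * be ^+ n / al ^+ n.
have vE n : (al ^+ n + e * be ^+ n) / s = v n * al ^+ n / s.
  by congr (_ / _); rewrite /v mulrDl mul1r divfK// gt_eqF.
have vn n : (i <= n)%N -> `|v n - 1| <= t.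
  move=> iN; rewrite /v addrC addKr !normrM e1 mul1r normrX normfV.
  rewrite [`|al ^+ n|]gtr0_norm//.
  apply: (@le_trans _ _ (1 * (al ^+ n)^-1)).
    by rewrite ler_pM2r ?invr_gt0// exprn_ile1.
  by rewrite mul1r /t lef_pV2 ?posrE// ler_weXn2l//; lra.
have := vn _ (leqnn i); rewrite {1}ler_distl => /andP[I1 I2].
have := vn _ ij; rewrite {1}ler_distl => /andP[j1 j2].
have := vn _ (leq_trans ij jk); rewrite {1}ler_distl => /andP[k1 k2].
have sp : 0 < s by lra.
set g := al ^ _.
have gE : al ^+ k = g * al ^+ i * al ^+ j.
  have al0 : al != 0 by rewrite gt_eqF.
  by rewrite /g !exprnP -!expfzDr//; congr (_ ^ _); ring.
(* Dividing the equation by [c * x * y * z] gives [z / (x * y) = d / c - E]. *)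
set E := (a * x ^+ 2 + b * y ^+ 2) / (c * x * y * z).
have y0 : 0 < y by lra.
have z0 : 0 < z by lra.
have zxy : z = (d / c - E) * (x * y).
  apply: (@mulfI _ (c * z)); first by rewrite mulf_neq0// gt_eqF.
  transitivity (d * x * y * z - (a * x ^+ 2 + b * y ^+ 2)).
    by rewrite -eqn; ring.
  by rewrite /E; field; rewrite !gt_eqF.
have E0 : 0 <= E.
  by rewrite /E; apply: divr_ge0; rewrite ?addr_ge0 ?mulr_ge0 ?sqr_ge0// ltW.
(* Both squares are at most [y * z], and [a + b <= 2 * c]. *)
have Ex : E * x <= 2.
  have -> : E * x = (a * x ^+ 2 + b * y ^+ 2) / (c * (y * z)).
    by rewrite /E; field; rewrite !gt_eqF.
  rewrite ler_pdivrMr; last by rewrite !mulr_gt0.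
  have h1 : x ^+ 2 <= y * z by nra.
  have h2 : y ^+ 2 <= y * z by nra.
  have h3 : 0 < y * z by rewrite mulr_gt0.
  nra.
have xt : x * t = v i / s.
  by rewrite xE vE /t; field; rewrite !gt_eqF.
(* Here [x * t = v i / s] and [v i >= 1/2], so [4 * (s * t) * x >= 2]. *)
have Et : E <= 4 * (s * t).
  rewrite -(ler_pM2r x0); apply: (le_trans Ex).
  have -> : 4 * (s * t) * x = 4 * v i.
    by rewrite -mulrA -mulrA [t * x]mulrC xt; field; rewrite gt_eqF.
  lra.
have key : s * g * v k = v i * v j * (d / c - E).
  move: zxy; rewrite zE xE yE !vE gE => h.
  apply: (@mulfI _ (al ^+ i * al ^+ j / s ^+ 2)).
    by rewrite !mulf_neq0 ?invr_neq0 ?expf_neq0 ?gt_eqF.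
  transitivity (v k * (g * al ^+ i * al ^+ j) / s); first by field; rewrite gt_eqF.
  by rewrite h; field; rewrite !gt_eqF.
set r := d / c in key *.
have r0 : 0 <= r by rewrite divr_ge0// ltW.
have r3 : r <= 3 by rewrite ler_pdivrMr.
have -> : g - d / (c * s) = (s * g - r) / s.
  by rewrite /r; field; rewrite !gt_eqF.
rewrite normrM normfV (gtr0_norm sp) ler_pdivrMr//.
have vk0 : 0 < v k by lra.
rewrite -(ler_pM2r vk0) -{1}(gtr0_norm vk0) -normrM mulrBl key.
(* The two terms contribute at most [12 * t] and [9 * (s * t)], together [21 * (s * t)]; dividing by
   [v k >= 1/2] doubles this to 42. *)
have -> : v i * v j * (r - E) - r * v k = r * (v i * v j - v k) - v i * v j * E by ring.
apply: (le_trans (ler_normB _ _)).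
have h1 : `|v i * v j - v k| <= 4 * t.
  by rewrite ler_norml; apply/andP; split; nra.
have h2 : `|v i * v j * E| <= 9 * (s * t).
  have vv0 : 0 <= v i * v j by apply: mulr_ge0; lra.
  have vv : v i * v j <= 9 / 4 by nra.
  rewrite (ger0_norm (mulr_ge0 vv0 E0)).
  apply: (@le_trans _ _ (9 / 4 * (4 * (s * t)))); last by lra.
  exact: ler_pM.
have h3 : `|r * (v i * v j - v k)| <= 3 * (4 * t).
  by rewrite normrM (ger0_norm r0) ler_pM.
have st : t <= s * t by rewrite ler_peMl// ltW.
have stv : 42 * t * s * v k >= 21 * (s * t).
  have stp : 0 < s * t by rewrite mulr_gt0.
  nra.
lra.
Qed.

(** * From a lower bound on the distance to a bound on the index *)

Lemma min_dist_pow_ge0 (R : realType) (al x : R) : 0 <= min_dist_pow al x.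
Proof.
apply: lb_le_inf; first by exists `|al ^ 0 - x|, 0.
by move=> _ [I _ <-].
Qed.

Lemma min_dist_pow_le (R : realType) (al x : R) (I : int) :
  min_dist_pow al x <= `|al ^ I - x|.
Proof. by apply: ge_inf; [exists 0 => _ [J _ <-] | exists I]. Qed.

(** The crude chain [i <= 2 ^+ i <= al ^+ i] makes logarithms unnecessary. *)
Lemma le_of_exp_le (R : realType) (al M : R) (i : nat) :
  2 <= al -> al ^+ i <= M -> i%:R <= M.
Proof.
move=> al2; apply: le_trans; apply: (@le_trans _ _ (2 ^+ i)).
  by rewrite -natrX ler_nat ltnW// ltn_expl.
by rewrite lerXn2r ?nnegrE//; lra.
Qed.

(** Meant for one fixed parameter tuple, with [del] the positive minimum B0 or B1. *)
Lemma index_bound (R : realType) (al del : R) (i : nat) :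
  2 <= al -> 0 < del -> del <= 42 * (al ^+ i)^-1 -> (i <= Num.bound (42 / del))%N.
Proof.
move=> al2 del0; rewrite ler_pdivlMr ?exprn_gt0//; last by lra.
rewrite mulrC -ler_pdivlMr// => /(le_of_exp_le al2) iM.
have M0 : 0 <= 42 / del by rewrite divr_ge0// ltW.
by rewrite ltnW// -(ltr_nat R); apply: le_lt_trans iM (archi_boundP M0).
Qed.

(** Cancelling [al ^+ 4] leaves [al ^+ (i - 4) <= 42], so [i - 4 <= 42]. *)
Lemma index_bound_46 (R : realType) (al : R) (i : nat) :
  2 <= al -> (al ^+ 4)^-1 <= 42 * (al ^+ i)^-1 -> (i <= 46)%N.
Proof.
move=> al2; have al0 : 0 < al by lra.
have [i4|i4] := leqP i 4; first by lia.
rewrite ler_pdivlMr ?exprn_gt0// mulrC -{1}(subnK (ltnW i4)) exprD.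
rewrite mulfK ?expf_neq0 ?gt_eqF// => /(le_of_exp_le al2).
by rewrite ler_nat; lia.
Qed.

(** * Explicit distances to the powers of a large alpha *)

(** For [I >= 0] the power is at least 1 and [r / s <= 1/3]. For [I <= -2] the power is at most
    [(al ^+ 2)^-1], well below [(al + 1)^-1 <= r / s]. Only [I = -1] can bring the two close. *)
Lemma pow_dist_U (R : realType) (al be r : R) (I : int) :
  10 <= al -> `|be| <= 1 -> 1 <= al * `|be| -> r = 1 \/ 2 <= r <= 3 ->
  (al ^+ 4)^-1 <= `|al ^ I - r / (al - be)|.
Proof.
move=> al10 be1 albe rE; set s := al - be.
have /andP[b1 b2] : -1 <= be <= 1 by rewrite -ler_norml.
have s9 : 9 <= s by rewrite /s; lra.
have sp : 0 < s by lra.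
have sal : s <= al + 1 by rewrite /s; lra.
have alp : 0 < al by lra.
have r13 : 1 <= r <= 3 by case: rE => [->|]; lra.
have al41 : (al ^+ 4)^-1 <= 1 / 10.
  have : al ^+ 1 <= al ^+ 4 by rewrite ler_weXn2l//; lra.
  by rewrite -div1r ler_pdivrMr ?exprn_gt0// expr1; lra.
have rs : r / s <= 1 / 3 by rewrite ler_pdivrMr//; lra.
case: I => [n|[|n]].
- have aln : 1 <= al ^ n by rewrite -exprnP exprn_ege1//; lra.
  by rewrite ger0_norm; lra.
- (* The delicate exponent: alpha^-1 and 1 / s differ only by beta / (alpha s). *)
  have -> : al ^ (Negz 0) = al^-1 by [].
  have -> : al^-1 - r / s = - (((r - 1) * al + be) / (al * s)).
    by rewrite /s; field; rewrite !gt_eqF.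
  rewrite normrN normrM normfV (gtr0_norm (mulr_gt0 alp sp)).
  (* For [r = 1] only [be] remains, of size at least [al^-1]; for [r >= 2] the sum is at least
     [al - 1]. *)
  have h : al^-1 <= `|(r - 1) * al + be|.
    have [->|r2] := rE.
      by rewrite subrr mul0r add0r -div1r ler_pdivrMr// mulrC.
    rewrite ger0_norm; last by nra.
    by rewrite -div1r ler_pdivrMr//; nra.
  (* The exponent 4 comes from [s <= al + 1 <= al ^+ 2]. *)
  apply: (@le_trans _ _ (al^-1 / (al * s))); last first.
    by rewrite ler_pM2r ?invr_gt0 ?mulr_gt0.
  rewrite -invfM lef_pV2 ?posrE ?exprn_gt0 ?mulr_gt0//.
  have -> : al ^+ 4 = al * (al * (al ^+ 2)) by ring.
  by rewrite !ler_pM2l//; nra.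
- have h1 : al ^ (Negz n.+1) <= (al ^+ 2)^-1.
    have -> : al ^ (Negz n.+1) = (al ^+ n.+2)^-1 by [].
    rewrite lef_pV2 ?posrE ?exprn_gt0//.
    by rewrite ler_weXn2l//; lra.
  have h2 : (al + 1)^-1 <= r / s.
    rewrite ler_pdivlMr// mulrC ler_pdivrMr; last lra.
    nra.
  rewrite distrC; apply: (le_trans _ (ler_norm _)).
  apply: (@le_trans _ _ ((al + 1)^-1 - (al ^+ 2)^-1)); last by lra.
  rewrite -subr_ge0.
  have -> : (al + 1)^-1 - al ^- 2 - al ^- 4 =
     (al ^+ 4 - al ^+ 2 * (al + 1) - (al + 1)) / ((al + 1) * al ^+ 4).
    by field; rewrite !gt_eqF//; lra.
  apply: divr_ge0; last by rewrite mulr_ge0 ?exprn_ge0//; lra.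
  have a2 : al <= al ^+ 2 by nra.
  have a4 : al ^+ 4 = al ^+ 2 * al ^+ 2 by ring.
  rewrite a4; nra.
Qed.

(** Powers with [I <= 0] are at most 1 and the others at least 10, so the distance to [r] is at
    least 1. The value [r = 1] must be excluded, being the power with [I = 0]. *)
Lemma pow_dist_V (R : realType) (al r : R) (I : int) :
  10 <= al -> 2 <= r <= 3 -> (al ^+ 4)^-1 <= `|al ^ I - r|.
Proof.
move=> al10 r23; apply: (@le_trans _ _ 1).
  by rewrite invf_le1 ?exprn_gt0// ?exprn_ege1//; lra.
case: I => n.
  case: n => [|n]; first by rewrite expr0z distrC ger0_norm; lra.
  have : al <= al ^ n.+1.
    by rewrite -exprnP exprS ler_peMr ?exprn_ege1//; lra.
  by move=> h; rewrite ger0_norm; lra.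
have : al ^ Negz n <= 1.
  have -> : al ^ (Negz n) = (al ^+ n.+1)^-1 by [].
  by rewrite invf_le1 ?exprn_gt0// ?exprn_ege1//; lra.
by move=> h; rewrite distrC ger0_norm; lra.
Qed.

(** * The coefficient tuples, and absolute bounds on the index *)

(** By inspection of the six tuples. The inequality on [a + b] serves the error estimate; the
    dichotomy isolates the ratio [d / c = 1]. *)
Lemma markoff_rosenberger_bounds (a b c d : int) :
  (a, b, c, d) \in markoff_rosenberger ->
  [/\ 0 < a, 0 < b, 0 < c & a + b <= 2 * c] /\ (d = c \/ 2 * c <= d <= 3 * c).
Proof.
rewrite !inE => /or4P[/eqP[-> -> -> ->]|/eqP[-> -> -> ->]|/eqP[-> -> -> ->]|].
- by split=> //; left.
- by split=> //; right.
- by split=> //; left.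
case/or3P => /eqP[-> -> -> ->]; split=> //; by [left | right].
Qed.

Lemma markoff_rosenberger_ratio (R : realType) (a b c d : int) :
  (a, b, c, d) \in markoff_rosenberger ->
  (d%:~R / c%:~R = 1 :> R) \/ 2 <= (d%:~R / c%:~R : R) <= 3.
Proof.
case/markoff_rosenberger_bounds => -[_ _ c0 _].
have c0r : 0 < c%:~R :> R by rewrite ltr0z.
case=> [->|dc]; [left|right]; first by rewrite divff// gt_eqF.
by move: dc; rewrite -!(ler_int R) !intrM ler_pdivlMr// ler_pdivrMr.
Qed.

(** The parameters form a single tuple so that [uniform_bound] can range over a list of them; [B]
    stands for the nonvanishing of B0 or B1. *)
Definition lucas_solution (w : int -> int -> nat -> int)
    (B : int * int * (int * int * int * int) -> bool)
    (t : int * int * (int * int * int * int)) (i : nat) : Prop :=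
  let: (P, Q, (a, b, c, d)) := t in
  [/\ 2 <= P, Q != 0, - P - 1 <= Q, Q <= P - 1 & 0 < lucasD P Q] /\
  [/\ (a, b, c, d) \in markoff_rosenberger, B t &
    exists j k : nat, [/\ (1 <= i)%N, (i <= j)%N, (j <= k)%N &
      a * w P Q i ^+ 2 + b * w P Q j ^+ 2 + c * w P Q k ^+ 2
        = d * w P Q i * w P Q j * w P Q k]].

(** Covers both kinds: [e = -1] with [s] the square root of the discriminant for U, and [e = 1],
    [s = 1] for V. *)
Lemma lucas_approx (R : realType) (x0 x1 P Q : int) (e s : R)
    (al := lucas_alpha R P Q) (be := lucas_beta R P Q) :
  [/\ 2 <= P, Q != 0, - P - 1 <= Q, Q <= P - 1 & 0 < lucasD P Q] ->
  0 <= x0 -> x0 <= x1 -> 0 < x1 -> `|e| = 1 -> 1 <= s ->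
  (forall n, (lucas x0 x1 P Q n)%:~R = (al ^+ n + e * be ^+ n) / s) ->
  forall (a b c d : int) (i j k : nat) (w := lucas x0 x1 P Q),
  (a, b, c, d) \in markoff_rosenberger ->
  (1 <= i)%N -> (i <= j)%N -> (j <= k)%N ->
  a * w i ^+ 2 + b * w j ^+ 2 + c * w k ^+ 2 = d * w i * w j * w k ->
  `|al ^ (k%:Z - i%:Z - j%:Z) - d%:~R / (c%:~R * s)| <= 42 * (al ^+ i)^-1.
Proof.
move=> [P2 Q0 QP1 QP D0] x00 x01 x10 e1 s1 wE a b c d i j k w mr i1 ij jk eqn.
have [[a0 b0 c0 abc] dc] := markoff_rosenberger_bounds mr.
have wm := lucas_homo x00 x01 P2 QP.
have eqnR := congr1 (fun m : int => m%:~R : R) eqn.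
rewrite !expr2 !intrD !intrM -!expr2 in eqnR.
apply: (markoff_approx (e := e) (be := be) _ _ _ _ _ _ _ _ _ _ _ _ _ _ _ _ _ _ _ eqnR) => //.
- exact: alpha_ge2.
- exact: beta_norm_le1.
- by rewrite ltr0z; apply: (lt_le_trans x10); exact: (wm 1%N i).
- by rewrite ler_int; exact: wm.
- by rewrite ler_int; exact: wm.
- by rewrite ltr0z.
- by rewrite ltr0z.
- by rewrite ltr0z.
- by move: abc; rewrite -(ler_int R) intrD intrM.
- by rewrite ler0z; lia.
- have : d <= 3 * c by lia.
  by rewrite -(ler_int R) intrM.
Qed.

Lemma lucas_solution_bound w B :
  (forall t, exists C, forall n, lucas_solution w B t n -> (n <= C)%N) ->
  (forall P Q q n, 11 <= P -> lucas_solution w B (P, Q, q) n -> (n <= 46)%N) ->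
  exists C, forall t n, lucas_solution w B t n -> (n <= C)%N.
Proof.
move=> each large.
(* For [P <= 10] the constraints give [-11 <= Q <= 9], inside the listed range from -12 to 11. *)
have [C smallC] := uniform_bound
  [seq (PQ, q) | PQ <- [seq (n%:Z, m%:Z - 12) | n <- iota 0 11, m <- iota 0 24],
                 q <- markoff_rosenberger] each.
exists (maxn C 46) => -[[P Q] q] n sol; rewrite leq_max.
have [P11|P11] := leP 11 P; first by rewrite (large _ _ _ _ P11 sol) orbT.
rewrite (smallC _ _ _ sol)//.
case: q sol => [[[a b] c] d] [[P2 _ QP1 QP _] [mr _ _]].
apply: allpairs_f => //.
apply/allpairsP; exists (`|P|%N, `|(Q + 12)%R|%N).
by rewrite !mem_iota /=; split; [lia | lia | congr pair; lia].
Qed.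

Lemma lucasU_index_bound (R : realType) : exists C, forall t n,
  lucas_solution lucasU (fun t => let: (P, Q, (a, b, c, d)) := t in
    min_dist_pow (lucas_alpha R P Q)
      (d%:~R / (c%:~R * Num.sqrt (lucasD P Q)%:~R)) != 0) t n -> (n <= C)%N.
Proof.
have approx P Q a b c d i j k (al := lucas_alpha R P Q) :
    [/\ 2 <= P, Q != 0, - P - 1 <= Q, Q <= P - 1 & 0 < lucasD P Q] ->
    (a, b, c, d) \in markoff_rosenberger ->
    (1 <= i)%N -> (i <= j)%N -> (j <= k)%N ->
    a * lucasU P Q i ^+ 2 + b * lucasU P Q j ^+ 2 + c * lucasU P Q k ^+ 2
      = d * lucasU P Q i * lucasU P Q j * lucasU P Q k ->
    `|al ^ (k%:Z - i%:Z - j%:Z) - d%:~R / (c%:~R * Num.sqrt (lucasD P Q)%:~R)|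
      <= 42 * (al ^+ i)^-1.
  move=> PQ; have [P2 Q0 QP1 QP D0] := PQ.
  apply: (lucas_approx (e := -1)) => //; first by rewrite normrN1.
    exact: sqrtD_ge1.
  by move=> n; rewrite mulN1r; exact: lucasU_closed.
apply: lucas_solution_bound => [[[P Q] [[[a b] c] d]]|P Q [[[a b] c] d] i P11].
  exists (Num.bound (42 / min_dist_pow (lucas_alpha R P Q)
    (d%:~R / (c%:~R * Num.sqrt (lucasD P Q)%:~R)))) => i.
  move=> [PQ [mr B0 [j [k [i1 ij jk eqn]]]]]; have [P2 Q0 QP1 QP D0] := PQ.
  apply: (@index_bound _ (lucas_alpha R P Q)).
  - exact: alpha_ge2.
  - by rewrite lt_neqAle eq_sym B0 min_dist_pow_ge0.
  - exact: le_trans (min_dist_pow_le _ _ _) (approx _ _ _ _ _ _ _ _ _ PQ mr i1 ij jk eqn).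
move=> [PQ [mr _ [j [k [i1 ij jk eqn]]]]]; have [P2 Q0 QP1 QP D0] := PQ.
apply: (@index_bound_46 _ (lucas_alpha R P Q)); first exact: alpha_ge2.
apply: le_trans (approx _ _ _ _ _ _ _ _ _ PQ mr i1 ij jk eqn).
(* Brings the target to the form [r / (al - be)] with [r = d / c]. *)
rewrite [(c%:~R * _)^-1]invfM [d%:~R * _]mulrA -alpha_sub_beta; apply: pow_dist_U.
- by have := P_le_alpha R P2 Q0 QP1 QP D0; move: P11; rewrite -(ler_int R); lra.
- exact: beta_norm_le1.
- exact: beta_norm_ge.
- exact: markoff_rosenberger_ratio mr.
Qed.

Lemma lucasV_index_bound (R : realType) : exists C, forall t n,
  lucas_solution lucasV (fun t => let: (P, Q, (a, b, c, d)) := t in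
    min_dist_pow (lucas_alpha R P Q) (d%:~R / c%:~R) != 0) t n -> (n <= C)%N.
Proof.
have approx P Q a b c d i j k (al := lucas_alpha R P Q) :
    [/\ 2 <= P, Q != 0, - P - 1 <= Q, Q <= P - 1 & 0 < lucasD P Q] ->
    (a, b, c, d) \in markoff_rosenberger ->
    (1 <= i)%N -> (i <= j)%N -> (j <= k)%N ->
    a * lucasV P Q i ^+ 2 + b * lucasV P Q j ^+ 2 + c * lucasV P Q k ^+ 2
      = d * lucasV P Q i * lucasV P Q j * lucasV P Q k ->
    `|al ^ (k%:Z - i%:Z - j%:Z) - d%:~R / c%:~R| <= 42 * (al ^+ i)^-1.
  move=> PQ mr i1 ij jk eqn; have [P2 Q0 QP1 QP D0] := PQ.
  rewrite -[c%:~R in leLHS]mulr1.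
  apply: (lucas_approx (e := 1) _ _ _ _ _ _ _ mr i1 ij jk eqn) => //.
  - by move: P2; lia.
  - by rewrite normr1.
  - by move=> n; rewrite mul1r divr1; exact: lucasV_closed.
apply: lucas_solution_bound => [[[P Q] [[[a b] c] d]]|P Q [[[a b] c] d] i P11].
  exists (Num.bound (42 / min_dist_pow (lucas_alpha R P Q) (d%:~R / c%:~R))) => i.
  move=> [PQ [mr B1 [j [k [i1 ij jk eqn]]]]]; have [P2 Q0 QP1 QP D0] := PQ.
  apply: (@index_bound _ (lucas_alpha R P Q)).
  - exact: alpha_ge2.
  - by rewrite lt_neqAle eq_sym B1 min_dist_pow_ge0.
  - exact: le_trans (min_dist_pow_le _ _ _) (approx _ _ _ _ _ _ _ _ _ PQ mr i1 ij jk eqn).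
move=> [PQ [mr B1 [j [k [i1 ij jk eqn]]]]]; have [P2 Q0 QP1 QP D0] := PQ.
apply: (@index_bound_46 _ (lucas_alpha R P Q)); first exact: alpha_ge2.
apply: le_trans (approx _ _ _ _ _ _ _ _ _ PQ mr i1 ij jk eqn).
apply: pow_dist_V.
  by have := P_le_alpha R P2 Q0 QP1 QP D0; move: P11; rewrite -(ler_int R); lra.
(* If [d / c = 1], the exponent 0 attains distance 0, contradicting the nonvanishing of B1. *)
case: (markoff_rosenberger_ratio R mr) => // dc1; move: B1.
have := min_dist_pow_le (lucas_alpha R P Q) (d%:~R / c%:~R) 0.
by rewrite expr0z dc1 subrr normr0 eq_le min_dist_pow_ge0 => ->.
Qed.

Theorem theorem1 (R : realType) :
  exists p0 p1 : recfun 6,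
  forall (P Q : int),
    2 <= P -> Q != 0 -> - P - 1 <= Q -> Q <= P - 1 -> 0 < lucasD P Q ->
    let alpha : R := lucas_alpha R P Q in
    let beta : R := lucas_beta R P Q in
    let sqrtD : R := Num.sqrt (lucasD P Q)%:~R in
    (forall n : nat, (0 < n)%N -> ~~ n.-unity_root (alpha / beta)) ->
  forall s1 s2 t1 t2 i1 i2 j1 j2 : R,
    0 < s1 -> 0 < s2 -> 0 < t1 -> 0 < t2 ->
    (forall k : nat, (1 <= k)%N ->
       s1 * alpha `^ (k%:R - i1) <= (lucasU P Q k)%:~R
         <= s2 * alpha `^ (k%:R + i2)) ->
    (forall k : nat, (1 <= k)%N ->
       t1 * alpha `^ (k%:R - j1) <= (lucasV P Q k)%:~R
         <= t2 * alpha `^ (k%:R + j2)) ->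
  forall a b c d : int, (a, b, c, d) \in markoff_rosenberger ->
    let B0 : R := min_dist_pow alpha (d%:~R / (c%:~R * sqrtD)) in
    let B1 : R := min_dist_pow alpha (d%:~R / c%:~R) in
    (B0 != 0 ->
     exists C0 : nat, computes p0 (input P Q a b c d) C0 /\
       forall i j k : nat, (1 <= i)%N -> (i <= j)%N -> (j <= k)%N ->
         let x := lucasU P Q i in
         let y := lucasU P Q j in
         let z := lucasU P Q k in
         a * x ^+ 2 + b * y ^+ 2 + c * z ^+ 2 = d * x * y * z ->
         (i <= C0)%N)
    /\
    (B1 != 0 ->
     exists C1 : nat, computes p1 (input P Q a b c d) C1 /\
       forall i j k : nat, (1 <= i)%N -> (i <= j)%N -> (j <= k)%N ->
         let x := lucasV P Q i in
         let y := lucasV P Q j in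
         let z := lucasV P Q k in
         a * x ^+ 2 + b * y ^+ 2 + c * z ^+ 2 = d * x * y * z ->
         (i <= C1)%N).
Proof.
(* Both bounds hold for all parameters at once, so the programs can be fixed before any parameter is
   introduced. *)
have [C0 C0P] := lucasU_index_bound R; have [C1 C1P] := lucasV_index_bound R.
have [p0 p0P] := computes_const 6 C0; have [p1 p1P] := computes_const 6 C1.
exists p0, p1 => P Q P2 Q0 QP1 QP D0 alpha beta sqrtD _.
move=> s1 s2 t1 t2 i1 i2 j1 j2 _ _ _ _ _ _ a b c d mr B0 B1; split=> B.
  exists C0; split=> // i j k i_gt0 ij jk x y z eqn.
  by apply: (C0P (P, Q, (a, b, c, d))); do 2![split=> //]; exists j, k.
exists C1; split=> // i j k i_gt0 ij jk x y z eqn.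
by apply: (C1P (P, Q, (a, b, c, d))); do 2![split=> //]; exists j, k.
Qed.
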